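(* Let $\mathscr{F}\subseteq\mathscr{P}(\omega)$ be an $\omega$-closed family. The semigroup $\boldsymbol{B}_{\mathbb{Z}}^{\mathscr{F}}$ is isomorphic to the extended bicyclic semigroup if and only if $\mathscr{F}=\{F\}$ where $F$ is a nonempty inductive subset of $\omega$.
   Context: $\omega$ is the set of non-negative integers and $\mathscr{P}(\omega)$ is the family of all its subsets. For $n\in\mathbb{Z}$ and $A\subseteq\mathbb{Z}$ put $n+A=\{n+a: a\in A\}$ (so $n+\varnothing=\varnothing$). A family $\mathscr{F}\subseteq\mathscr{P}(\omega)$ is $\omega$-closed if $F_1\cap(-n+F_2)\in\mathscr{F}$ for all $n\in\omega$ and $F_1,F_2\in\mathscr{F}$. For an $\omega$-closed family $\mathscr{F}$, the set $\mathbb{Z}\times\mathbb{Z}\times\mathscr{F}$ carries the associative operation $$(i_1,j_1,F_1)\cdot(i_2,j_2,F_2)=\begin{cases}(i_1-j_1+i_2,\;j_2,\;(j_1-i_2+F_1)\cap F_2), & j_1<i_2;\\ (i_1,\;j_2,\;F_1\cap F_2), & j_1=i_2;\\ (i_1,\;j_1-i_2+j_2,\;F_1\cap(i_2-j_1+F_2)), & j_1>i_2.\end{cases}$$ If $\varnothing\in\mathscr{F}$, then $\boldsymbol{I}=\{(i,j,\varnothing): i,j\in\mathbb{Z}\}$ is an ideal and $\boldsymbol{B}_{\mathbb{Z}}^{\mathscr{F}}$ is defined as the Rees quotient $(\mathbb{Z}\times\mathbb{Z}\times\mathscr{F},\cdot)/\boldsymbol{I}$ ($\boldsymbol{I}$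 is collapsed to one element, the zero); if $\varnothing\notin\mathscr{F}$, then $\boldsymbol{B}_{\mathbb{Z}}^{\mathscr{F}}=(\mathbb{Z}\times\mathbb{Z}\times\mathscr{F},\cdot)$. The extended bicyclic semigroup is $\boldsymbol{B}_{\mathbb{Z}}=\mathbb{Z}\times\mathbb{Z}$ with the operation $(i_1,j_1)\cdot(i_2,j_2)=(i_1+i_2-\min\{j_1,i_2\},\,j_1+j_2-\min\{j_1,i_2\})$. A subset $A\subseteq\omega$ is inductive if $i\in A$ implies $i+1\in A$. *)

(* Defs.v *)
From HB Require Import structures.
From mathcomp Require Import all_boot all_order all_algebra.
From mathcomp Require Import boolp classical_sets.
From mathcomp Require Import zify.

Set Implicit Arguments.
Unset Strict Implicit.
Unset Printing Implicit Defensive.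

Import Order.TTheory GRing.Theory Num.Theory.
Local Open Scope classical_set_scope.
Local Open Scope ring_scope.
Local Open Scope quotient_scope.

(* The subsets of omega are represented as sets of integers contained in
   [omega], so that the translates -n + F can be formed without coercions. *)
Definition omega : set int := range Posz.

Definition translate (n : int) (A : set int) : set int := [set n + a | a in A].

Definition omega_closed (FF : set (set int)) : Prop :=
  forall (n : nat) (F1 F2 : set int),
    FF F1 -> FF F2 -> FF (F1 `&` translate (- n%:Z) F2).

Definition inductive (A : set int) : Prop := forall i, A i -> A (i + 1).

Definition isomorphic (S T : semigroupType) : Prop :=
  exists f : {multiplicative S -> T}, bijective f.

Section Rees.
Variable S : semigroupType.
Implicit Types (I : set S) (x y : S).

Definition ideal I : Prop :=
  forall x y, I x -> I (x * y)%g /\ I (y * x)%g.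

Definition rees_rel I : rel S := fun x y => `[< x = y \/ (I x /\ I y) >].

Lemma rees_rel_refl I : reflexive (rees_rel I).
Proof. by move=> x; apply/asboolP; left. Qed.

Lemma rees_rel_sym I : symmetric (rees_rel I).
Proof. by move=> x y; apply/asboolP/asboolP => -[->|[]]; by [left|right]. Qed.

Lemma rees_rel_trans I : transitive (rees_rel I).
Proof.
move=> y x z /asboolP[->//|[Ix Iy]] /asboolP[<-|[_ Iz]];
  by apply/asboolP; right.
Qed.

Canonical rees_equiv I :=
  EquivRel (rees_rel I) (@rees_rel_refl I) (@rees_rel_sym I)
    (@rees_rel_trans I).

Definition rees I (idI : ideal I) : Type := {eq_quot rees_rel I}.

Variables (I : set S) (idI : ideal I).

HB.instance Definition _ := Choice.copy (rees idI) {eq_quot rees_rel I}.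
HB.instance Definition _ :=
  EqQuotient.copy (rees idI) {eq_quot rees_rel I}.

Definition rees_mul (a b : rees idI) : rees idI :=
  \pi_(rees idI) (repr a * repr b)%g.

Lemma pi_rees (x y : S) :
  \pi_(rees idI) x = \pi_(rees idI) y <-> x = y \/ (I x /\ I y).
Proof.
by split=> [/eqP|h]; [rewrite eqmodE => /asboolP|apply/eqP; rewrite eqmodE; apply/asboolP].
Qed.

Lemma rees_mulE (x y : S) :
  rees_mul (\pi_(rees idI) x) (\pi_(rees idI) y) = \pi_(rees idI) (x * y)%g.
Proof.
apply/pi_rees.
have /pi_rees [->|[Ix Ix']] := reprK (\pi_(rees idI) x);
have /pi_rees [->|[Iy Iy']] := reprK (\pi_(rees idI) y); first by left.
- by right; split; [case: (idI x Iy)|case: (idI x Iy')].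
- by right; split; [case: (idI y Ix)|case: (idI y Ix')].
- by right; split; [case: (idI (repr (\pi_(rees idI) y)) Ix)|case: (idI y Ix')].
Qed.

Lemma rees_mulA : associative rees_mul.
Proof.
elim/(@quotW _ (rees idI))=> x; elim/(@quotW _ (rees idI))=> y.
by elim/(@quotW _ (rees idI))=> z; rewrite !rees_mulE mulgA.
Qed.

HB.instance Definition _ := isSemigroup.Build (rees idI) rees_mulA.

End Rees.

(* The case formula makes sense on Z x Z x P(Z); Z x Z x FF is obtained below
   as the subsemigroup [triple_on FF], for an omega-closed FF. *)
Definition triple : Type := (int * int * set int)%type.
HB.instance Definition _ := Choice.on triple.

Definition triple_mul (x y : triple) : triple :=
  let: (i1, j1, F1) := x in
  let: (i2, j2, F2) := y in
  if j1 < i2 then (i1 - j1 + i2, j2, translate (j1 - i2) F1 `&` F2)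
  else if j1 == i2 then (i1, j2, F1 `&` F2)
  else (i1, j1 - i2 + j2, F1 `&` translate (i2 - j1) F2).

Lemma translateE n A x : translate n A x = A (x - n).
Proof.
rewrite propeqE; split=> [[a Aa <-]|h]; first by rewrite addrC addKr.
by exists (x - n) => //; rewrite addrC subrK.
Qed.

Lemma triple_eq (i j i' j' : int) (F F' : set int) :
  i = i' -> j = j' -> (forall x, F x <-> F' x) ->
  (i, j, F) = (i', j', F') :> triple.
Proof. by move=> -> -> h; congr (_, _, _); apply/seteqP; split=> x /h. Qed.

Lemma set_arg (A : set int) x y : A x -> x = y -> A y.
Proof. by move=> Ax <-. Qed.

Lemma triple_mulA : associative triple_mul.
Proof.
move=> [[i1 j1] F1] [[i2 j2] F2] [[i3 j3] F3]; rewrite /triple_mul.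
case: (ltgtP j2 i3) => h23; case: (ltgtP j1 i2) => h12 //;
  repeat (case: ltgtP => ? //); try lia;
  (apply: triple_eq; [lia|lia|move=> x]; rewrite /setI /= ?translateE /=;
   split; rewrite ?translateE; move=> [] ? ?;
   repeat match goal with H : _ /\ _ |- _ => destruct H end;
   repeat split; try (eapply set_arg; [eassumption|lia])).
Qed.

HB.instance Definition _ := isSemigroup.Build triple triple_mulA.

Section ExtendedFamily.
Variable FF : set (set int).

Definition triple_on : set triple := [set x | FF x.2].

Lemma triple_on_mulg_closed :
  omega_closed FF -> mulg_closed (fun x : triple => x \in triple_on).
Proof.
move=> FFw.
have shiftw (n : int) F1 F2 : n < 0 -> FF F1 -> FF F2 -> FF (F1 `&` translate n F2).
  case: n => // n _ h1 h2; have := FFw n.+1 _ _ h1 h2.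
  by rewrite -NegzE.
move=> x y /set_mem + /set_mem +; rewrite /triple_on /= => h1 h2.
apply/mem_set; move: x y h1 h2 => [[i1 j1] F1] [[i2 j2] F2] /= h1 h2.
change (FF (triple_mul (i1, j1, F1) (i2, j2, F2)).2); rewrite /triple_mul.
case: (ltgtP j1 i2) => h12 /=.
- by rewrite setIC; apply: shiftw => //; lia.
- by apply: shiftw => //; lia.
- have := FFw 0%N _ _ h1 h2; congr (FF (_ `&` _)); apply/funext => x.
  by rewrite translateE oppr0 subr0.
Qed.

Variable FFw : omega_closed FF.

(* [FFw] is a parameter of the type because its operation depends on it. *)
Definition ext_triples of omega_closed FF : Type :=
  {x : triple | x \in triple_on}.

HB.instance Definition _ := SubChoice.on (ext_triples FFw).
HB.instance Definition _ :=
  SubChoice_isSubSemigroup.Build triple _ (ext_triples FFw)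
    (triple_on_mulg_closed FFw).

Definition empty_triples : set (ext_triples FFw) :=
  [set x | (val x).2 = set0].

Lemma ideal_empty_triples : ideal empty_triples.
Proof.
have shift0 n : translate n set0 = set0 by rewrite /translate image_set0.
move=> x y; rewrite /empty_triples /=.
case: (val x) (val y) => [[i1 j1] F1] [[i2 j2] F2] /= ->.
change ((triple_mul (i1, j1, set0) (i2, j2, F2)).2 = set0 /\
        (triple_mul (i2, j2, F2) (i1, j1, set0)).2 = set0).
by rewrite /triple_mul; split; case: ltgtP => _ /=; rewrite ?shift0 ?setI0 ?set0I.
Qed.

Definition BZ_family : semigroupType :=
  if pselect (FF set0) then (rees ideal_empty_triples : semigroupType)
  else (ext_triples FFw : semigroupType).

End ExtendedFamily.

Definition ext_bicyclic : Type := (int * int)%type.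
HB.instance Definition _ := Choice.on ext_bicyclic.

Definition ext_bicyclic_mul (x y : ext_bicyclic) : ext_bicyclic :=
  let: (i1, j1) := x in
  let: (i2, j2) := y in
  (i1 + i2 - Num.min j1 i2, j1 + j2 - Num.min j1 i2).

Lemma ext_bicyclic_mulA : associative ext_bicyclic_mul.
Proof.
move=> [i1 j1] [i2 j2] [i3 j3] /=; congr (_, _); lia.
Qed.

HB.instance Definition _ := isSemigroup.Build ext_bicyclic ext_bicyclic_mulA.

(* Main.v *)
Require Import Defs.
From HB Require Import structures.
From mathcomp Require Import all_boot all_order all_algebra.
From mathcomp Require Import boolp classical_sets.
From mathcomp Require Import zify.

(** The extended bicyclic semigroup has no zero, which excludes the Rees
    quotient, and it is bisimple.  An element witnessing that the idempotents
    (0,0,F1) and (0,0,F2) are D-related must have the form (0,0,A), and its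
    inverse the form (0,0,B), so F1 = A `&` B = F2: the family is a singleton
    {F}, and omega-closure then gives F `&` (-1 + F) = F, i.e. F is inductive.
    Conversely, over a singleton {F} the third coordinate carries no
    information. *)

Import Order.TTheory GRing.Theory Num.Theory.
Local Open Scope classical_set_scope.
Local Open Scope ring_scope.
Local Open Scope quotient_scope.

Lemma ext_bicyclicM (i1 j1 i2 j2 : int) :
  (((i1, j1) : ext_bicyclic) * ((i2, j2) : ext_bicyclic))%g =
  (i1 + i2 - Num.min j1 i2, j1 + j2 - Num.min j1 i2).
Proof. by []. Qed.

(** Multiplying [(a, b)] on the right by [(b, b + 1)] yields [(a, b + 1)]. *)
Lemma ext_bicyclic_no_left_zero (z : ext_bicyclic) :
  ~ (forall x : ext_bicyclic, (z * x)%g = z).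
Proof.
case: z => a b /(_ (b, b + 1)); rewrite ext_bicyclicM => -[]; lia.
Qed.

(* For idempotents e and f this is Green's relation D. *)
Definition D_linked (S : semigroupType) (e f : S) : Prop :=
  exists x y : S, [/\ (x * y)%g = e, (y * x)%g = f,
    (e * x)%g = x /\ (x * f)%g = x & (f * y)%g = y /\ (y * e)%g = y].

(** Idempotents are the diagonal pairs; [(p, r)] and its inverse [(r, p)] link [(p, p)] to
    [(r, r)]. *)
Lemma ext_bicyclic_bisimple (e f : ext_bicyclic) :
  (e * e)%g = e -> (f * f)%g = f -> D_linked _ e f.
Proof.
case: e f => [p q] [r s]; rewrite !ext_bicyclicM => -[ep eq] -[er es].
have <- : p = q by lia.
have <- : r = s by lia.
exists ((p, r) : ext_bicyclic), ((r, p) : ext_bicyclic).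
by split; [| |split|split]; rewrite ext_bicyclicM; congr (_, _); lia.
Qed.

Lemma D_linked_inj (S T : semigroupType) (f : {multiplicative S -> T})
    (e e' : S) :
  bijective f -> D_linked T (f e) (f e') -> D_linked S e e'.
Proof.
move=> [g fK gK] [x [y [xy yx [ex xe'] [e'y ye]]]].
have finj := can_inj fK.
exists (g x), (g y); split; [| |split|split];
  by apply: finj; rewrite gmulfM ?gK.
Qed.

Lemma triple_mulE (x y : triple) : (x * y)%g = triple_mul x y.
Proof. by []. Qed.

Lemma triple_zero_idem (F : set int) :
  (((0, 0, F) : triple) * ((0, 0, F) : triple))%g = (0, 0, F).
Proof. by rewrite triple_mulE /triple_mul ltxx eqxx setIid. Qed.

Lemma triple_D_linked (F1 F2 : set int) :
  D_linked triple (0, 0, F1) (0, 0, F2) -> F1 = F2.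
Proof.
move=> [[[a b] A] [[[c d] B] []]]; rewrite !triple_mulE /triple_mul.
move=> xy yx [ex xf] [fy ye].
(* A product with a factor at indices [(0, 0)] replaces a negative adjacent index by 0, so the
   absorption laws force all four indices to be nonnegative. *)
have a_ge0 : 0 <= a by move: ex; case: ltgtP => ? [] *; lia.
have b_ge0 : 0 <= b by move: xf; case: ltgtP => ? [] *; lia.
have c_ge0 : 0 <= c by move: fy; case: ltgtP => ? [] *; lia.
have d_ge0 : 0 <= d by move: ye; case: ltgtP => ? [] *; lia.
(* In a product the first index is at least that of the left factor, and the second at least that of
   the right factor. *)
have [a0 d0] : a = 0 /\ d = 0 by move: xy; case: ltgtP => ? [] *; lia.
have [c0 b0] : c = 0 /\ b = 0 by move: yx; case: ltgtP => ? [] *; lia.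
move: xy yx; rewrite a0 b0 c0 d0 ltxx eqxx => -[<-] [<-].
by rewrite setIC.
Qed.

Lemma singleton_omega_closed_inductive (F : set int) :
  omega_closed [set F] -> inductive F.
Proof.
move=> /(_ 1%N F F erefl erefl) /= FE i.
by rewrite -{1}FE => -[_]; rewrite translateE opprK.
Qed.

Section ExtTriples.
Variables (FF : set (set int)) (FF_closed : omega_closed FF).

Lemma mem_triple_on (i j : int) (F : set int) :
  FF F -> (i, j, F) \in triple_on FF.
Proof. by move=> FFF; apply/mem_set. Qed.

Definition ext_triple (i j : int) (F : set int) (FFF : FF F) :
  ext_triples FF_closed := Sub (i, j, F) (mem_triple_on i j F FFF).

Lemma val_ext_triplesM (x y : ext_triples FF_closed) :
  val (x * y)%g = (val x * val y)%g.
Proof. exact: gmulfM. Qed.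

Lemma isomorphic_ext_bicyclic_subsingleton (F1 F2 : set int) :
  isomorphic (ext_triples FF_closed) ext_bicyclic ->
  FF F1 -> FF F2 -> F1 = F2.
Proof.
move=> [f fbij] FF1 FF2.
pose e F (FFF : FF F) := ext_triple 0 0 F FFF.
have idem F FFF : (e F FFF * e F FFF)%g = e F FFF.
  by apply: val_inj; rewrite val_ext_triplesM /= triple_zero_idem.
have : D_linked _ (e F1 FF1) (e F2 FF2).
  apply: (D_linked_inj _ _ f) => //.
  by apply: ext_bicyclic_bisimple; rewrite -gmulfM idem.
move=> [x [y [xy yx [ex xe'] [e'y ye]]]].
(* The inclusion [val] is multiplicative, so it carries the link to [triple]. *)
apply: triple_D_linked; exists (val x), (val y).
split; [| |split|split];
  by [rewrite -val_ext_triplesM xy | rewrite -val_ext_triplesM yx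
     | rewrite -[in RHS]ex val_ext_triplesM | rewrite -[in RHS]xe' val_ext_triplesM
     | rewrite -[in RHS]e'y val_ext_triplesM | rewrite -[in RHS]ye val_ext_triplesM].
Qed.

Definition ext_indices (x : ext_triples FF_closed) : ext_bicyclic := (val x).1.

(** The three cases of [triple_mul] evaluate [Num.min j1 i2], whatever the family. *)
Lemma ext_indicesM : {morph ext_indices : x y / (x * y)%g >-> (x * y)%g}.
Proof.
move=> x y; rewrite /ext_indices val_ext_triplesM triple_mulE.
case: (val x) (val y) => [[i1 j1] F1] [[i2 j2] F2].
rewrite /= [RHS]ext_bicyclicM.
by case: ltgtP => h /=; congr (_, _); lia.
Qed.

HB.instance Definition _ :=
  isMultiplicative.Build (ext_triples FF_closed) ext_bicyclic ext_indices
    ext_indicesM.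

Lemma singleton_isomorphic (F : set int) :
  FF = [set F] -> isomorphic (ext_triples FF_closed) ext_bicyclic.
Proof.
move=> FFE; have FFF : FF F by rewrite FFE.
exists ext_indices; exists (fun p => ext_triple p.1 p.2 F FFF).
  move=> x; apply: val_inj; rewrite /= /ext_indices.
  have := set_mem (valP x); rewrite /triple_on /= {1}FFE /=.
  by case: (val x) => [[i j] A] /= ->.
by case.
Qed.

(** The collapsed ideal is the zero; [FF0] makes it nonempty. *)
Lemma rees_left_zero (FF0 : FF set0) :
  exists z : rees (@ideal_empty_triples FF FF_closed),
    forall x, (z * x)%g = z.
Proof.
have Iz : empty_triples (ext_triple 0 0 set0 FF0) by [].
exists (\pi_(rees (@ideal_empty_triples FF FF_closed)) (ext_triple 0 0 set0 FF0)).
elim/quotW => x.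
rewrite [LHS]rees_mulE; apply/pi_rees; right; split => //.
by case: (@ideal_empty_triples FF FF_closed _ x Iz).
Qed.

Lemma isomorphic_ext_bicyclic_no_left_zero (S : semigroupType) (z : S) :
  isomorphic S ext_bicyclic -> ~ (forall x, (z * x)%g = z).
Proof.
move=> [f [g _ gK]] zl; apply: (ext_bicyclic_no_left_zero (f z)) => x.
by rewrite -[x]gK -gmulfM zl.
Qed.

End ExtTriples.

Theorem mainTheorem9 (FF : set (set int))
    (FF_sub : forall F : set int, FF F -> F `<=` omega)
    (FF_closed : omega_closed FF) :
  isomorphic (BZ_family FF_closed) ext_bicyclic <->
  exists F : set int,
    [/\ F `<=` omega, F !=set0, inductive F & FF = [set F]].
Proof.
rewrite /BZ_family; case: pselect => FF0 /=; split.
- have [z zl] := rees_left_zero FF FF_closed FF0.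
  by move=> /isomorphic_ext_bicyclic_no_left_zero /(_ zl).
- move=> [F [_ [x Fx] _ FFE]]; exfalso.
  by move: FF0 Fx; rewrite FFE /= => <-.
- move=> iso; have [f [g _ _]] := iso.
  (* Pulling back [(0, 0)] along the isomorphism gives a triple, hence a member of [FF]. *)
  have [F FFF] : exists F, FF F.
    have := set_mem (valP (g (0, 0))); rewrite /triple_on /=.
    by exists (val (g (0, 0))).2.
  have FFE : FF = [set F].
    apply/seteqP; split => [A FFA|_ -> //].
    exact: isomorphic_ext_bicyclic_subsingleton iso FFA FFF.
  exists F; split => //; first exact: FF_sub.
    (* Nonemptiness of [F] comes from the case assumption that the empty set is not in [FF]. *)
    by apply/set0P/eqP => F0; apply: FF0; rewrite -F0.
  by apply: singleton_omega_closed_inductive; rewrite -FFE.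
- by move=> [F [_ _ _ FFE]]; exact: singleton_isomorphic FFE.
Qed.
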